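(* Let $\mathcal{X}=\{1,\dots,n\}$, let $X$ be a random variable on $\mathcal{X}$ with distribution $p_X$, let $\mathcal{H}$ be a finite-dimensional Hilbert space, and let $\mathcal{E}=\{(\rho_x,p_X(x))\}_{x\in\mathcal{X}}$ be a quantum ensemble of density matrices on $\mathcal{H}$. Then the three definitions of the quantum guesswork coincide: $$G_1(X|\mathcal{E})=G_2(X|\mathcal{E})=G(X|\mathcal{E}).$$
   Context: $\mathcal{S}_n$ is the set of permutations of $\{1,\dots,n\}$. A POVM on $\mathcal{H}$ is a family $E=\{E_y\}_{y\in\mathcal{Y}}$, indexed by an arbitrary alphabet $\mathcal{Y}$ (which may depend on $E$), of positive semidefinite operators on $\mathcal{H}$ with $\sum_{y\in\mathcal{Y}}E_y=I$. Given $E$ and $\mathcal{E}$, $Y_E$ is the $\mathcal{Y}$-valued random variable whose joint law with $X$ is $p_{X,Y_E}(x,y)=p_X(x)\operatorname{Tr}[E_y\rho_x]$. A guessing strategy is a map $\sigma:\mathcal{Y}\to\mathcal{S}_n$, $y\mapsto\sigma_y$ (where $\sigma_y(i)$ is the $i$-th guess when $y$ is observed), and its conditional guesswork is $$\mathcal{G}_\sigma(X|Y_E)=\sum_{y\in\mathcal{Y}}\sum_{i=1}^n i\cdot p_{X,Y_E}(\sigma_y(i),y).$$ The three definitions are: (i) $G(X|\mathcal{E})=\min_{\sigma,E}\mathcal{G}_\sigma(X|Y_E)$, over all POVMs $E$ on $\mathcal{H}$ and all strategies $\sigma$ on the outcome set of $E$. (ii) $G_1(X|\mathcal{E})=\inf_E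 G(X|Y_E)$, over all POVMs $E$ on $\mathcal{H}$, where $G(X|Y_E)$ is the classical conditional guessing entropy $G(X|Y)=\min_\sigma\mathcal{G}_\sigma(X|Y)=\mathbb{E}_Y\sum_{i=1}^n i\cdot p^{\downarrow}_{X|Y}(x_i|Y)$ taken at $Y=Y_E$; here, for each $y$, $p^{\downarrow}_{X|Y}(x_1|y)\ge\dots\ge p^{\downarrow}_{X|Y}(x_n|y)$ denote the conditional probabilities $p_{X|Y}(x|y)$, $x\in\mathcal{X}$, sorted in descending order. (iii) $G_2(X|\mathcal{E})=\inf_E\sum_{i=1}^n i\cdot p(i)$, over all POVMs $E=\{E_\sigma\}_{\sigma\in\mathcal{S}_n}$ on $\mathcal{H}$ indexed by permutations, where $p(i)=\sum_{\sigma\in\mathcal{S}_n}\operatorname{Tr}[E_\sigma\rho_{\sigma(i)}]\,p_X(\sigma(i))$. *)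

(* Defs.v *)
From mathcomp Require Import all_boot all_order all_algebra perm.
From mathcomp Require Import complex.
From mathcomp Require Import all_classical all_reals all_analysis.
From mathcomp Require Import summability.

Set Implicit Arguments.
Unset Strict Implicit.
Unset Printing Implicit Defensive.

Import Order.TTheory GRing.Theory Num.Theory.
Import numFieldNormedType.Exports.

Local Open Scope classical_set_scope.
Local Open Scope ring_scope.
Local Open Scope sesquilinear_scope.

(* Packaging [R[i]] as a [numClosedFieldType] gives it, and the matrices over
   it, their usual topology through [numFieldNormedType]. *)
Definition Cplx (R : realType) : numClosedFieldType := R[i].

Definition is_min (R : realType) (S : set (\bar R)) (m : \bar R) : Prop :=
  S m /\ forall g, S g -> (m <= g)%E.

Section Classical.
Variables (R : realType) (n : nat) (Y : choiceType).

(* A joint law of [(X, Y)] is given by its mass function [q x y]. The values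
   [1, ..., n] of [X] are encoded as [0, ..., n-1] in ['I_n], so the [i]-th
   guess costs [i.+1]. *)
Variable q : 'I_n -> Y -> R.

(* [s y i] is the guess number [i.+1] when [y] is observed. *)
Definition strategy_guesswork (s : Y -> 'S_n) : \bar R :=
  \esum_(y in [set: Y]) (\sum_(i < n) i.+1%:R * q (s y i) y)%:E.

Definition marginal (y : Y) : R := \sum_(x < n) q x y.

(* If [marginal y = 0] this is [0], and [y] has no weight in [guesswork]. *)
Definition conditional (x : 'I_n) (y : Y) : R := q x y / marginal y.

Definition sorted_conditional (y : Y) : seq R :=
  sort >=%R [seq conditional x y | x : 'I_n].

Definition guesswork : \bar R :=
  \esum_(y in [set: Y])
    (marginal y * \sum_(i < n) i.+1%:R * (sorted_conditional y)`_i)%:E.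

End Classical.

Section Quantum.
Variables (R : realType) (n d : nat).
Local Notation C := (Cplx R).

(* [0 <= z] in [C] means that [z] is real and nonnegative; in particular
   a positive semidefinite matrix is hermitian. *)
Definition psd (A : 'M[C]_d) : Prop :=
  forall v : 'cV[C]_d, 0 <= (v ^t* *m A *m v) 0 0.

Definition density (rho : 'M[C]_d) : Prop := psd rho /\ \tr rho = 1.

(* The alphabet [Y] is arbitrary, possibly infinite: the sum over [Y] is
   the limit of the net of its finite partial sums. *)
Record povm (Y : choiceType) := Povm {
  povm_elt :> Y -> 'M[C]_d;
  povm_psd : forall y, psd (povm_elt y);
  povm_sum : partial_sum povm_elt @ totally --> (1%:M : 'M[C]_d) }.

Variables (p : 'I_n -> R) (rho : 'I_n -> 'M[C]_d).

(* [\tr (A *m B)] is real when [A] and [B] are positive semidefinite, so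
   taking the real part only changes its type. *)
Definition joint (Y : choiceType) (E : povm Y) (x : 'I_n) (y : Y) : R :=
  p x * complex.Re (\tr (E y *m rho x)).

Definition quantum_values : set (\bar R) :=
  [set g | exists (Y : choiceType) (E : povm Y) (s : Y -> 'S_n),
     g = strategy_guesswork (joint E) s].

(* That this infimum is a minimum is part of the statement. *)
Definition quantum_guesswork : \bar R := ereal_inf quantum_values.

Definition quantum_guesswork1 : \bar R :=
  ereal_inf [set g | exists (Y : choiceType) (E : povm Y),
    g = guesswork (joint E)].

Definition guess_prob (E : povm 'S_n) (i : 'I_n) : R :=
  \sum_(s : 'S_n) complex.Re (\tr (E s *m rho (s i))) * p (s i).

Definition quantum_guesswork2 : \bar R :=
  ereal_inf [set g | exists E : povm 'S_n,
    g = (\sum_(i < n) i.+1%:R * guess_prob E i)%:E].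

End Quantum.

Section Rearrangement.
Variables (R : realType) (n : nat).

Lemma weighted_sum_tails (g : 'I_n -> R) :
  \sum_(i < n) i.+1%:R * g i = \sum_(k < n) \sum_(i < n | (k <= i)%N) g i.
Proof.
rewrite (exchange_big_dep predT) //=; apply: eq_bigr => i _.
rewrite -(big_ord_widen n (fun=> g i) (ltn_ord i)).
by rewrite sumr_const card_ord mulr_natl.
Qed.

Lemma nonincreasing_rearrangement (a : 'I_n -> R) (s : 'S_n) :
  (forall i j : 'I_n, (i <= j)%N -> a j <= a i) ->
  \sum_(i < n) i.+1%:R * a i <= \sum_(i < n) i.+1%:R * a (s i).
Proof.
move=> a_noninc; rewrite !weighted_sum_tails; apply: ler_sum => k _.
have shift (g : 'I_n -> R) : \sum_(i < n | (k <= i)%N) g i =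
    \sum_(i < n | (k <= i)%N) (g i - a k) + \sum_(i < n | (k <= i)%N) a k.
  by rewrite -big_split /=; apply: eq_bigr => i _; rewrite subrK.
rewrite shift [leRHS]shift lerD2r.
have -> : \sum_(i < n | (k <= i)%N) (a i - a k) =
    \sum_(i < n) Num.min (a i - a k) 0.
  rewrite [RHS](bigID (fun i : 'I_n => (k <= i)%N)) /=.
  rewrite [X in _ = _ + X]big1 ?addr0; last first.
    move=> i; rewrite -ltnNge => /ltnW /a_noninc.
    by rewrite -subr_ge0 => /min_r.
  by apply: eq_bigr => i /a_noninc; rewrite -subr_le0 => /min_l.
rewrite (reindex_perm s) (bigID (fun i : 'I_n => (k <= i)%N)) /=.
rewrite -[leRHS]addr0; apply: lerD; last first.
  by apply: sumr_le0 => i _; rewrite ge_min lexx orbT.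
by apply: ler_sum => i _; rewrite ge_min lexx.
Qed.

Lemma sorted_rearrangement (f : 'I_n -> R) :
  let t := sort >=%R [seq f x | x : 'I_n] in
  (exists s : 'S_n,
     \sum_(i < n) i.+1%:R * t`_i = \sum_(i < n) i.+1%:R * f (s i))
  /\ forall s : 'S_n,
     \sum_(i < n) i.+1%:R * t`_i <= \sum_(i < n) i.+1%:R * f (s i).
Proof.
move=> t.
have st : size t = n by rewrite size_sort size_map -cardE card_ord.
have tP (i : 'I_n) : t`_i = tnth (Tuple (introT eqP st)) i.
  by rewrite (tnth_nth 0).
have [u uP] : exists u : 'S_n, forall i : 'I_n, t`_i = f (u i).
  have : perm_eq t [tuple f i | i < n].
    by rewrite perm_sort /= perm_refl.
  move=> /(@tuple_permP _ _ t) [u tE]; exists u => i.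
  by rewrite tE (nth_map i) ?size_enum_ord // nth_ord_enum !tnth_mktuple.
have t_noninc (i j : 'I_n) : (i <= j)%N -> t`_j <= t`_i.
  move=> ij; apply: (@sorted_leq_nth _ (>=%R)) => //.
  - by move=> x y z /= yx zy; apply: le_trans zy _.
  - exact: lexx.
  - by apply: sort_sorted => x y; exact: le_total.
  - by rewrite inE st.
  - by rewrite inE st.
split; first by exists u; apply: eq_bigr => i _; rewrite uP.
move=> s.
have := @nonincreasing_rearrangement (fun i => t`_i) (s * u^-1)%g t_noninc.
by under [leRHS]eq_bigr => i _ do rewrite uP permM permKV.
Qed.

End Rearrangement.

(* [guesswork] is also the least conditional guesswork of a strategy. *)
Lemma guesswork_is_min (R : realType) (n : nat) (Y : choiceType)
    (q : 'I_n -> Y -> R) :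
  (forall x y, 0 <= q x y) ->
  is_min [set g | exists s : Y -> 'S_n, g = strategy_guesswork q s]
    (guesswork q).
Proof.
move=> q_ge0.
have m_ge0 y : 0 <= marginal q y by apply: sumr_ge0.
have qE x y : q x y = marginal q y * conditional q x y.
  rewrite /conditional mulrC; have [m0|m0] := eqVneq (marginal q y) 0.
    rewrite m0 mulr0; move/eqP: m0; rewrite psumr_eq0 // => /allP/(_ x).
    by rewrite mem_index_enum => /(_ isT)/eqP.
  by rewrite divfK.
have costE (s : 'S_n) y : \sum_(i < n) i.+1%:R * q (s i) y =
    marginal q y * \sum_(i < n) i.+1%:R * conditional q (s i) y.
  by rewrite mulr_sumr; apply: eq_bigr => i _; rewrite qE mulrCA.
have sorted_ge0 y : 0 <=
    marginal q y * \sum_(i < n) i.+1%:R * (sorted_conditional q y)`_i.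
  apply: mulr_ge0 => //.
  have [[s ->] _] := sorted_rearrangement (conditional q ^~ y).
  by apply: sumr_ge0 => i _; rewrite mulr_ge0 // divr_ge0.
split.
  have /choice [s sP] y := (sorted_rearrangement (conditional q ^~ y)).1.
  by exists s; apply: eq_esum => y _; rewrite costE -sP.
move=> _ [s ->]; apply: le_esum => y _.
rewrite lee_fin costE ler_wpM2l //.
exact: (sorted_rearrangement (conditional q ^~ y)).2.
Qed.

(* Main.v *)
(** Merging the outcomes of a POVM on which a strategy makes the same guesses
    yields a POVM indexed by permutations with the same guesswork, and sorting
    is optimal for a fixed measurement; so the three infima agree. The minimum
    is attained because the POVMs indexed by permutations form a compact set on
    which the guesswork is continuous. For an infinite alphabet only the
    outcomes in a finite set [A] are merged, and the positive remainder
    [1 - \sum_(y in A) E_y] is added to the element of the identity permutation: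
    its cost tends to [0] as [A] grows. *)

Require Import Defs.
From HB Require Import structures.
From mathcomp Require Import all_boot all_order all_algebra perm.
From mathcomp Require Import all_classical all_reals all_analysis.
From mathcomp Require Import complex summability spectral sesquilinear finmap.
From mathcomp Require Import lra.

Set Implicit Arguments.
Unset Strict Implicit.
Unset Printing Implicit Defensive.

Import Order.TTheory GRing.Theory Num.Theory.
Import numFieldNormedType.Exports.

Local Open Scope classical_set_scope.
Local Open Scope ring_scope.
Local Open Scope sesquilinear_scope.

(* Continuity of linear functionals, and sums over finite sets *)
#[local] Existing Instance totally_filter.

(** In finite dimension a linear functional is a finite combination of matrix entries, and each
    entry is continuous. *)
Lemma scalar_continuous (K : numFieldType) m n (f : 'M[K]_(m, n) -> K) :
  scalar f -> continuous f.
Proof.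
move=> fS.
pose fL := GRing.isLinear.Build K 'M[K]_(m, n) K *%R f fS.
pose g : {scalar 'M[K]_(m, n)} := HB.pack f fL.
have -> : f = fun M => \sum_i \sum_j M i j * f (delta_mx i j).
  apply/funext => M; rewrite -[LHS]/(g M) {1}[M]matrix_sum_delta linear_sum.
  apply: eq_bigr => i _; rewrite linear_sum.
  by apply: eq_bigr => j _; rewrite linearZ.
apply: continuous_big => [|i _]; first exact: add_continuous.
apply: continuous_big => [|j _]; first exact: add_continuous.
move=> M; apply: (@continuous_comp _ _ _
  (fun M : 'M[K]_(m, n) => M i j) ( *%R^~ _)).
  exact: coord_continuous.
exact: mulrr_continuous.
Qed.

Lemma partial_sumE (Y : choiceType) (V : zmodType) (x : Y -> V) (A : {fset Y}) :
  partial_sum x A = \sum_(y <- A) x y.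
Proof. by rewrite /partial_sum big_seq_fsetE. Qed.

Lemma esum_finType (R : realType) (T : finType) (a : T -> R) :
  (forall t, 0 <= a t) ->
  \esum_(t in [set: T]) (a t)%:E = (\sum_t a t)%:E.
Proof.
move=> a0; rewrite esum_fset; last 2 first.
- exact: finite_finset.
- by move=> t _; rewrite lee_fin.
rewrite fsumEFin; last exact: finite_finset.
rewrite -[in RHS]big_enum [in RHS]fsbig_seq ?enum_uniq //=.
have -> // : [set` enum T] = [set: T].
by apply/seteqP; split=> t //= _; rewrite mem_enum.
Qed.

(** * Real parts, imaginary parts and the order of the complex numbers *)

Section Complex.
Variable R : realType.
Local Notation C := (Cplx R).

Lemma Cplx_ge0 (z : C) :
  (0 <= z) = (complex.Im z == 0) && (0 <= complex.Re z).
Proof. by rewrite lecE. Qed.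

Lemma ReD (z w : C) : complex.Re (z + w) = complex.Re z + complex.Re w.
Proof. by case: z w => [a b] [c e]. Qed.

Lemma Re_continuous : continuous (@complex.Re R : C -> R).
Proof.
move=> z A /nbhs_ballP[e /= e0 eA]; apply/nbhs_ballP.
exists (e%:C%C : C); first by rewrite /= ltcR.
move=> w /= zw; apply: eA.
rewrite -ball_normE /= -ltcR; apply: le_lt_trans zw.
by have := normc_ge_Re (z - w); case: z w => [a b] [a' b'].
Qed.

Lemma Im_continuous : continuous (@complex.Im R : C -> R).
Proof.
have -> : (@complex.Im R : C -> R) =
    (@complex.Re R : C -> R) \o ( *%R^~ (- 'i%C)).
  by apply/funext => -[a b] /=; lra.
move=> z; apply: continuous_comp; first exact: mulrr_continuous.
exact: Re_continuous.
Qed.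

Lemma closed_Cplx_ge0 : closed [set z : C | 0 <= z].
Proof.
have -> : [set z : C | 0 <= z] =
    (@complex.Im R @^-1` [set 0]) `&` (@complex.Re R @^-1` [set x | 0 <= x]).
  apply/seteqP; split=> z /=; rewrite Cplx_ge0.
    by move=> /andP[/eqP].
  by move=> [/eqP -> ->].
apply: closedI.
  apply: preimage_closed => [z _|]; first exact: Im_continuous.
  exact: (@closed_eq R 0).
apply: preimage_closed => [z _|]; first exact: Re_continuous.
exact: closed_ge.
Qed.

End Complex.

(** * Positive semidefinite matrices: entries, traces, closedness *)

Section PositiveMatrices.
Variables (R : realType) (d : nat).
Local Notation C := (Cplx R).
Implicit Types A B : 'M[C]_d.

Definition form A (u v : 'cV[C]_d) : C := (u ^t* *m A *m v) 0 0.

Lemma form_delta A i j :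
  form A (delta_mx i 0) (delta_mx j 0) = A i j.
Proof. by rewrite /form trmx_delta map_delta_mx -rowE -colE !mxE. Qed.

Lemma formDl A u1 u2 v : form A (u1 + u2) v = form A u1 v + form A u2 v.
Proof. by rewrite /form linearD /= map_mxD !mulmxDl mxE. Qed.

Lemma formDr A u v1 v2 : form A u (v1 + v2) = form A u v1 + form A u v2.
Proof. by rewrite /form mulmxDr mxE. Qed.

Lemma formZl A c u v : form A (c *: u) v = c^* * form A u v.
Proof. by rewrite /form linearZ /= map_mxZ -!scalemxAl mxE. Qed.

Lemma formZr A c u v : form A u (c *: v) = c * form A u v.
Proof. by rewrite /form -scalemxAr mxE. Qed.

(** This is the quadratic form of [A] at [e_i + c e_j]; varying [c] isolates the off-diagonal
    entries. *)
Lemma psd_pair_ge0 A i j c : psd A ->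
  0 <= A i i + c * A i j + c^* * A j i + c * c^* * A j j.
Proof.
move=> /(_ (delta_mx i 0 + c *: delta_mx j 0)).
rewrite -/(form A _ _) formDl !formDr !formZl !formZr !form_delta !addrA.
by rewrite mulrCA mulrA.
Qed.

Lemma psd_diag_ge0 A i : psd A -> 0 <= A i i.
Proof. by move/(_ (delta_mx i 0)); rewrite -/(form _ _ _) form_delta. Qed.

(** Polarization with [c] equal to 1, -1, i and -i: the four values are real, which gives hermitian
    symmetry, and nonnegative, which gives the two bounds. *)
Lemma psd_pair_Re_Im A i j : psd A ->
  [/\ A j i = (A i j)^*,
   2 * `|complex.Re (A i j)| <= complex.Re (A i i) + complex.Re (A j j)
   & 2 * `|complex.Im (A i j)| <= complex.Re (A i i) + complex.Re (A j j)].
Proof.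
move=> Apsd.
have := psd_diag_ge0 i Apsd; have := psd_diag_ge0 j Apsd.
have := psd_pair_ge0 i j 1 Apsd; have := psd_pair_ge0 i j (-1) Apsd.
have := psd_pair_ge0 i j 'i%C Apsd; have := psd_pair_ge0 i j (- 'i%C) Apsd.
rewrite !Cplx_ge0.
case: (A i i) => [a1 b1]; case: (A j j) => [a2 b2].
case: (A i j) => [a3 b3]; case: (A j i) => [a4 b4] /=.
move=> /andP[/eqP h1 k1] /andP[/eqP h2 k2] /andP[/eqP h3 k3] /andP[/eqP h4 k4].
move=> /andP[/eqP h5 k5] /andP[/eqP h6 k6]; split.
- rewrite -[RHS]/(a3 +i* - b3)%C; congr (_ +i* _)%C; lra.
- by case: (ger0P a3) => _; lra.
- by case: (ger0P b3) => _; lra.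
Qed.

Lemma psd_hermsymmx A : psd A -> A \is hermsymmx.
Proof.
move=> Apsd; apply/is_hermitianmxP; rewrite expr0 scale1r.
by apply/matrixP => i j; rewrite !mxE; have [] := psd_pair_Re_Im j i Apsd.
Qed.

Lemma psd_congr A (M : 'M[C]_d) : psd A -> psd (M *m A *m M ^t*).
Proof.
move=> Apsd v; have := Apsd (M ^t* *m v).
by rewrite trmx_mul map_mxM trmxCK !mulmxA.
Qed.

(** Diagonalize [B] by a unitary [P]. The trace becomes the sum over [k] of the eigenvalue [D_k]
    times the [k]-th diagonal entry of [P A P^*]; both factors are diagonal entries of positive
    semidefinite matrices. *)
Lemma psd_mxtrace_mul_ge0 A B : psd A -> psd B -> 0 <= \tr (A *m B).
Proof.
move=> Apsd Bpsd.
have /orthomx_spectralP Beq := hermitian_normalmx (psd_hermsymmx Bpsd).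
set P := spectralmx B in Beq; set D := spectral_diag B in Beq.
have PU : P \is unitarymx by exact: spectral_unitarymx.
have PP : P *m P ^t* = 1%:M by apply/unitarymxP.
rewrite invmx_unitary // in Beq.
have DE : P *m B *m P ^t* = diag_mx D.
  by rewrite Beq !mulmxA PP mul1mx -!mulmxA PP mulmx1.
rewrite Beq mulmxA mxtrace_mulC !mulmxA mxtrace_mulC /mxtrace.
apply: sumr_ge0 => k _.
rewrite mul_diag_mx mxE mulr_ge0 //.
  have := psd_diag_ge0 k (psd_congr P Bpsd).
  by rewrite DE mxE eqxx mulr1n.
exact: psd_diag_ge0 k (psd_congr P Apsd).
Qed.

Lemma psd0 : psd (0 : 'M[C]_d).
Proof. by move=> v; rewrite mulmx0 mul0mx mxE. Qed.

Lemma psdD A B : psd A -> psd B -> psd (A + B).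
Proof. by move=> Apsd Bpsd v; rewrite mulmxDr mulmxDl mxE addr_ge0. Qed.

Lemma psd_sum (I : Type) (r : seq I) (P : pred I) (F : I -> 'M[C]_d) :
  (forall i, P i -> psd (F i)) -> psd (\sum_(i <- r | P i) F i).
Proof.
move=> Fpsd; apply: (big_ind (@psd R d)) => //; first exact: psd0.
exact: psdD.
Qed.

(** The diagonal entries are at most 1, and they dominate the others by [psd_pair_Re_Im]. This makes
    the set of POVMs bounded. *)
Lemma psd_entry_le1 A i j : psd A -> psd (1%:M - A) ->
  `|complex.Re (A i j)| <= 1 /\ `|complex.Im (A i j)| <= 1.
Proof.
move=> Apsd Bpsd.
have diag k : complex.Re (A k k) <= 1.
  have := psd_diag_ge0 k Bpsd; rewrite !mxE eqxx mulr1n Cplx_ge0 => /andP[_].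
  by case: (A k k) => a b /=; rewrite subr_ge0.
have [_] := psd_pair_Re_Im i j Apsd.
by have := diag i; have := diag j; split; lra.
Qed.

Lemma closed_psd : closed [set A : 'M[C]_d | psd A].
Proof.
have -> : [set A : 'M[C]_d | psd A] =
    \bigcap_(v in setT) ((fun A => form A v v) @^-1` [set z : C | 0 <= z]).
  apply/seteqP; split=> A /=; first by move=> Apsd v _; exact: Apsd.
  by move=> Apsd v; exact: Apsd.
apply: closed_bigI => v _; apply: preimage_closed; last exact: closed_Cplx_ge0.
move=> A _; apply: scalar_continuous => a B D.
by rewrite /form mulmxDr mulmxDl -scalemxAr -scalemxAl !mxE.
Qed.

Lemma Re_tr_continuous (W : 'M[C]_d) :
  continuous (fun A : 'M[C]_d => complex.Re (\tr (A *m W))).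
Proof.
move=> A; apply: (@continuous_comp _ _ _ (fun A : 'M[C]_d => \tr (A *m W))
  (@complex.Re R : C -> R)); last exact: Re_continuous.
by apply: scalar_continuous => a B D; rewrite mulmxDl -scalemxAl linearP.
Qed.

Lemma Re_tr_sum (W : 'M[C]_d) (I : Type) (r : seq I) (P : pred I)
    (F : I -> 'M[C]_d) :
  complex.Re (\tr ((\sum_(i <- r | P i) F i) *m W)) =
  \sum_(i <- r | P i) complex.Re (\tr (F i *m W)).
Proof.
apply: (big_morph (fun A => complex.Re (\tr (A *m W)))) => [A B|].
  by rewrite mulmxDl linearD ReD.
by rewrite mul0mx linear0.
Qed.

(** The remainder is the limit, over finite [B] containing [A], of the sums of [E] over [B] minus
    [A]. These sums are positive semidefinite, a closed condition. *)
Lemma psd_povm_tail (Y : choiceType) (E : povm R d Y) (A : {fset Y}) :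
  psd (1%:M - \sum_(y <- A) E y).
Proof.
apply: (@closed_cvg _ _ (@totally Y) _
  (fun B : {fset Y} => partial_sum E B - partial_sum E A) _ closed_psd);
  last first.
  rewrite -partial_sumE; apply: cvgB; first exact: povm_sum.
  exact: cvg_cst.
exists A => // B /= AB; rewrite !partial_sumE.
rewrite (big_fsetID _ (mem A) B) /=.
have -> : [fset x in B | x \in A]%fset = A.
  apply/fsetP => x; rewrite !inE /= andbC; case: (boolP (x \in A)) => //= xA.
  exact: (fsubsetP AB).
by rewrite addrAC subrr add0r; apply: psd_sum => y _; exact: povm_psd.
Qed.

End PositiveMatrices.

(** * Compactness of the POVMs on a finite alphabet, and minimization of a linear cost *)

Section FinitePovm.
Variables (R : realType) (d : nat) (Y : finType).
Local Notation C := (Cplx R).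
Local Notation N := #|{: Y * 'I_d * 'I_d * bool}|.

(* Real coordinates, because [bounded_closed_compact] is stated over a
   [realType]. *)
Definition decode (x : 'rV[R]_N) (y : Y) : 'M[C]_d :=
  \matrix_(i, j) (x 0 (enum_rank (y, i, j, false)) +i*
                  x 0 (enum_rank (y, i, j, true)))%C.

Definition encode (F : Y -> 'M[C]_d) : 'rV[R]_N :=
  \row_k let: (y, i, j, b) := enum_val k in
         if b then complex.Im (F y i j) else complex.Re (F y i j).

Lemma encodeK F : decode (encode F) = F.
Proof.
apply/funext => y; apply/matrixP => i j; rewrite !mxE !enum_rankK.
by case: (F y i j).
Qed.

Lemma decode_continuous y : continuous (decode^~ y).
Proof.
(* Radii of balls over [C] are themselves complex; positivity forces the imaginary part [e'] to be
   0. *)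
move=> x A /nbhs_ballP[[e e'] /= e0 eA].
move: e0; rewrite ltcE /= => /andP[/eqP e'0 e0].
(* If the real and imaginary parts both move by less than [e / 2], the squared modulus of the
   difference stays below [e ^ 2 / 2]. *)
apply/nbhs_ballP; exists (e / 2); first by rewrite /= divr_gt0.
move=> x' [_ xx']; apply: eA; split; first by rewrite ltcE /= e'0 eqxx.
move=> i j; rewrite !mxE.
have := xx' 0 (enum_rank (y, i, j, false)).
have := xx' 0 (enum_rank (y, i, j, true)).
rewrite -!ball_normE /= !ltr_norml => /andP[b1 b2] /andP[a1 a2].
rewrite e'0 normc_def ltcR -[ltRHS]gtr0_norm // -sqrtr_sqr.
rewrite ltr_sqrt ?exprn_gt0 //=.
by nra.
Qed.

(** An ordinary finite sum stands here for the limit in [povm_sum], so that closedness can be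
    checked in coordinates; [is_povmP] identifies the two notions. *)
Definition is_povm (F : Y -> 'M[C]_d) :=
  (forall y, psd (F y)) /\ \sum_y F y = 1%:M.

Lemma closed_is_povm : closed [set x | is_povm (decode x)].
Proof.
have -> : [set x | is_povm (decode x)] =
    (\bigcap_(y in setT) (decode^~ y @^-1` [set A | psd A])) `&`
    ((fun x => \sum_y decode x y) @^-1` [set 1%:M]).
  apply/seteqP; split=> x; first by move=> [h1 h2]; split=> // y _; exact: h1.
  by move=> [h1 h2]; split=> // y; exact: h1.
apply: closedI.
  apply: closed_bigI => y _; apply: preimage_closed; last exact: closed_psd.
  by move=> x _; exact: decode_continuous.
apply: preimage_closed; last first.
  apply: accessible_closed_set1; apply: hausdorff_accessible.
  exact: norm_hausdorff.
move=> x _; apply: continuous_big => [|y _]; first exact: add_continuous.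
exact: decode_continuous.
Qed.

Lemma psd_povm_compl (F : Y -> 'M[C]_d) y : is_povm F -> psd (1%:M - F y).
Proof.
move=> [Fpsd <-]; rewrite (bigD1 y) //= addrAC subrr add0r.
by apply: psd_sum => z _; exact: Fpsd.
Qed.

Lemma bounded_is_povm : bounded_set [set x | is_povm (decode x)].
Proof.
exists 1; split; first exact: num_real.
move=> M M1 x xpovm /=; rewrite [leLHS]/Num.norm /= mx_normrE.
apply: bigmax_le => [|[i k] _ /=]; first exact: le_trans ler01 (ltW M1).
apply: le_trans (ltW M1); rewrite ord1 -[k]enum_valK.
case: (enum_val k) => -[[y j] l] b.
have [] := psd_entry_le1 j l (xpovm.1 y) (psd_povm_compl y xpovm).
by rewrite !mxE /=; case: b.
Qed.

Lemma exists_min_povm (y0 : Y) (W : Y -> 'M[C]_d) :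
  exists F, is_povm F /\ forall G, is_povm G ->
    \sum_y complex.Re (\tr (F y *m W y)) <=
    \sum_y complex.Re (\tr (G y *m W y)).
Proof.
pose S := [set x | is_povm (decode x)].
have S0 : S !=set0.
  (* The trivial measurement, which always returns [y0]. *)
  exists (encode (fun y => if y == y0 then 1%:M else 0)).
  rewrite /S /= encodeK; split=> [y|]; last by rewrite -big_mkcond big_pred1_eq.
  case: ifP => _; last exact: psd0.
  move=> v; rewrite mulmx1 mxE sumr_ge0 // => i _.
  by rewrite !mxE mulrC mul_conjC_ge0.
have Scpt : compact S.
  apply: bounded_closed_compact; first exact: bounded_is_povm.
  exact: closed_is_povm.
pose V x := \sum_y complex.Re (\tr (decode x y *m W y)).
have Vcont : continuous V.
  apply: continuous_big => [|y _]; first exact: add_continuous.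
  move=> x; apply: (@continuous_comp _ _ _ (decode^~ y)
    (fun A : 'M[C]_d => complex.Re (\tr (A *m W y)))).
    exact: decode_continuous.
  exact: Re_tr_continuous.
have [|x] := EVT_min_rV S0 Scpt (f := V).
  by move=> x; apply: continuous_subspaceT.
move=> /set_mem xS xmin; exists (decode x); split=> // G Gpovm.
have := xmin (encode G); rewrite /V encodeK; apply.
by apply/mem_set; rewrite /S /= encodeK.
Qed.

(** The net is constant as soon as the finite set contains all of [Y]. *)
Lemma partial_sum_finType (F : Y -> 'M[C]_d) :
  partial_sum F @ totally --> \sum_y F y.
Proof.
apply: cvg_near_cst; exists [fset y in enum Y]%fset => // A /= sA.
rewrite partial_sumE -[RHS]big_enum; apply: perm_big.
apply: uniq_perm; rewrite ?enum_uniq ?fset_uniq // => y.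
by rewrite mem_enum (fsubsetP sA) // !inE mem_enum.
Qed.

Lemma is_povmP (F : Y -> 'M[C]_d) :
  is_povm F <-> exists E : povm R d Y, F = E.
Proof.
have Fcvg := @partial_sum_finType F.
split=> [[Fpsd F1]|[E FE]].
  by rewrite F1 in Fcvg; exists (Povm Fpsd Fcvg).
split; first by rewrite FE; exact: povm_psd.
apply: (@cvg_unique _ (@norm_hausdorff C 'M[C]_d) _ _ _ _ Fcvg).
by rewrite FE; exact: povm_sum.
Qed.

End FinitePovm.

(** * Guesswork as a linear function of the POVM, and reduction to outcomes in ['S_n] *)

Section Guesswork.
Variables (R : realType) (n d : nat).
Variables (p : 'I_n -> R) (rho : 'I_n -> 'M[Cplx R]_d).
Hypotheses (p_ge0 : forall x, 0 <= p x).
Hypotheses (rho_density : forall x, density (rho x)).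
Local Notation C := (Cplx R).

(** Pairing an outcome's operator with this matrix under the trace gives that outcome's contribution
    to the guesswork when the guesses follow [s]. For a fixed strategy the guesswork is thus linear
    in the POVM. *)
Definition cost_mx (s : 'S_n) : 'M[C]_d :=
  \sum_(i < n) (i.+1%:R * p (s i))%:C%C *: rho (s i).

Lemma Re_tr_cost_mx (A : 'M[C]_d) s :
  complex.Re (\tr (A *m cost_mx s)) =
  \sum_(i < n) i.+1%:R * (p (s i) * complex.Re (\tr (A *m rho (s i)))).
Proof.
rewrite (big_morph (fun B => complex.Re (\tr (A *m B)))
  (id1 := 0) (op1 := +%R)) => [|B D|]; first last.
- by rewrite mulmx0 linear0.
- by rewrite mulmxDr linearD ReD.
apply: eq_bigr => i _; rewrite -scalemxAr linearZ /= mulrA.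
by case: (\tr _) => a b /=; rewrite mul0r subr0.
Qed.

Lemma joint_ge0 (Y : choiceType) (E : povm R d Y) x y : 0 <= joint p rho E x y.
Proof.
rewrite mulr_ge0 //.
have := psd_mxtrace_mul_ge0 (povm_psd E y) (rho_density x).1.
by rewrite Cplx_ge0 => /andP[].
Qed.

Lemma strategy_guesswork_joint (Y : choiceType) (E : povm R d Y)
    (s : Y -> 'S_n) :
  strategy_guesswork (joint p rho E) s =
  \esum_(y in [set: Y]) (complex.Re (\tr (E y *m cost_mx (s y))))%:E.
Proof. by apply: eq_esum => y _; rewrite Re_tr_cost_mx. Qed.

Lemma Re_tr_cost_ge0 (Y : choiceType) (E : povm R d Y) y s :
  0 <= complex.Re (\tr (E y *m cost_mx s)).
Proof.
by rewrite Re_tr_cost_mx; apply: sumr_ge0 => i _; rewrite mulr_ge0 // joint_ge0.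
Qed.

Lemma guess_prob_cost (E : povm R d 'S_n) :
  \sum_(i < n) i.+1%:R * guess_prob p rho E i =
  \sum_s complex.Re (\tr (E s *m cost_mx s)).
Proof.
under [RHS]eq_bigr do rewrite Re_tr_cost_mx.
rewrite exchange_big; apply: eq_bigr => i _.
rewrite /guess_prob mulr_sumr; apply: eq_bigr => s _.
by rewrite [X in _ * X]mulrC.
Qed.

(** When the outcome is itself a permutation, guessing in the announced order is the strategy [id];
    the values defining [quantum_guesswork2] are therefore among [quantum_values]. *)
Lemma strategy_guesswork_id (E : povm R d 'S_n) :
  strategy_guesswork (joint p rho E) id =
  (\sum_(i < n) i.+1%:R * guess_prob p rho E i)%:E.
Proof.
rewrite strategy_guesswork_joint guess_prob_cost esum_finType // => s.
exact: Re_tr_cost_ge0.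
Qed.

Definition coarse_grain (Y : choiceType) (E : povm R d Y) (s : Y -> 'S_n)
    (A : {fset Y}) (t : 'S_n) : 'M[C]_d :=
  \sum_(y <- A | s y == t) E y +
  (if t == 1%g then 1%:M - \sum_(y <- A) E y else 0).

Lemma is_povm_coarse_grain (Y : choiceType) (E : povm R d Y) s A :
  is_povm (coarse_grain E s A).
Proof.
split=> [t|].
  apply: psdD; first by apply: psd_sum => y _; exact: povm_psd.
  by case: ifP => _; [exact: psd_povm_tail|exact: psd0].
rewrite big_split /= (exchange_big_dep predT) //=.
rewrite -big_mkcond big_pred1_eq addrC -[RHS](subrK (\sum_(y <- A) E y)).
by congr (_ + _); apply: eq_bigr => y _; rewrite (big_pred1 (s y)).
Qed.

Lemma coarse_grain_cost (Y : choiceType) (E : povm R d Y) s (A : {fset Y}) :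
  \sum_t complex.Re (\tr (coarse_grain E s A t *m cost_mx t)) =
  \sum_(y <- A) complex.Re (\tr (E y *m cost_mx (s y))) +
  complex.Re (\tr ((1%:M - \sum_(y <- A) E y) *m cost_mx 1%g)).
Proof.
under eq_bigr do rewrite mulmxDl linearD ReD Re_tr_sum.
rewrite big_split /= (exchange_big_dep predT) //=; congr (_ + _).
  by apply: eq_bigr => y _; rewrite (big_pred1 (s y)).
rewrite (bigD1 (1%g : 'S_n)) //= eqxx [X in _ + X]big1 ?addr0 // => t /negPf ->.
by rewrite mul0mx linear0.
Qed.

Lemma min_le_strategy_guesswork (F : 'S_n -> 'M[C]_d) :
  (forall G, is_povm G ->
     \sum_t complex.Re (\tr (F t *m cost_mx t)) <=
     \sum_t complex.Re (\tr (G t *m cost_mx t))) ->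
  forall (Y : choiceType) (E : povm R d Y) (s : Y -> 'S_n),
  ((\sum_t complex.Re (\tr (F t *m cost_mx t)))%:E <=
   strategy_guesswork (joint p rho E) s)%E.
Proof.
move=> Fmin Y E s; rewrite strategy_guesswork_joint.
set v := \sum_t _.
have part_le (A : {fset Y}) :
    ((\sum_(y <- A) complex.Re (\tr (E y *m cost_mx (s y))))%:E <=
     \esum_(y in [set: Y]) (complex.Re (\tr (E y *m cost_mx (s y))))%:E)%E.
  apply: esum_ge; exists [set` A]; first by split.
  by rewrite fsumEFin // lee_fin -fsbig_seq ?fset_uniq.
(* The empty partial sum is 0, which rules out the value [-oo]; at [+oo] the bound is trivial. *)
have := part_le fset0; case: (\esum_(y in _) _) part_le => [g|_ _|_].
- move=> part_le _; rewrite lee_fin -subr_le0.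
  pose tail (A : {fset Y}) :=
    complex.Re (\tr ((1%:M - partial_sum E A) *m cost_mx 1%g)).
  (* Minimality against the coarse-grained POVM gives [v <= g + tail A] for every finite [A], and
     [tail] tends to 0 along the net. *)
  apply: (@closed_cvg _ _ (@totally Y) _ tail (fun x : R => v - g <= x)).
  + exact: closed_ge.
  + apply: nearW => A; rewrite lerBlDl.
    apply: le_trans (Fmin _ (is_povm_coarse_grain E s A)) _.
    by rewrite coarse_grain_cost /tail partial_sumE lerD2r -lee_fin.
  + have -> : 0 = complex.Re (\tr ((1%:M - 1%:M : 'M[C]_d) *m cost_mx 1%g)).
      by rewrite subrr mul0mx linear0.
    have tail_cvg : (1%:M - partial_sum E A : 'M[C]_d) @[A --> totally] -->
        (1%:M - 1%:M : 'M[C]_d).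
      by apply: cvgB; [exact: cvg_cst|exact: povm_sum].
    exact: continuous_cvg _ (@Re_tr_continuous R d (cost_mx 1%g) _) tail_cvg.
- exact: leey.
- by rewrite leeNy_eq.
Qed.

End Guesswork.

(** * The cycle of inequalities between the three infima *)

Theorem theorem1 (R : realType) (n d : nat)
    (p : 'I_n -> R) (rho : 'I_n -> 'M[Cplx R]_d)
    (p_ge0 : forall x, 0 <= p x) (p_sum1 : \sum_(x < n) p x = 1)
    (rho_density : forall x, density (rho x)) :
  [/\ is_min (quantum_values p rho) (quantum_guesswork p rho),
      quantum_guesswork1 p rho = quantum_guesswork2 p rho
    & quantum_guesswork2 p rho = quantum_guesswork p rho].
Proof.
have [F [/is_povmP[E0 ->] E0min]] :=
  exists_min_povm (1%g : 'S_n) (cost_mx p rho).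
have E0le := min_le_strategy_guesswork E0min.
have v_id := strategy_guesswork_id p_ge0 rho_density E0.
rewrite -guess_prob_cost -v_id in E0le.
have quantumE :
    quantum_guesswork p rho = strategy_guesswork (joint p rho E0) id.
  apply/eqP; rewrite eq_le; apply/andP; split.
    by apply: ereal_inf_lbound; exists 'S_n, E0, id.
  by apply: le_ereal_inf_tmp => _ [Y [E [s ->]]]; exact: E0le.
(* Sorting is realized by some strategy, so each value defining [quantum_guesswork1] is one of
   [quantum_values]. *)
have le01 : (quantum_guesswork p rho <= quantum_guesswork1 p rho)%E.
  apply: le_ereal_inf_tmp => _ [Y [E ->]].
  have [[s ->] _] := guesswork_is_min (joint_ge0 p_ge0 rho_density E).
  by apply: ereal_inf_lbound; exists Y, E, s.
(* For a fixed POVM on ['S_n], sorting costs no more than the strategy [id]. *)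
have le12 : (quantum_guesswork1 p rho <= quantum_guesswork2 p rho)%E.
  apply: le_ereal_inf_tmp => _ [E ->]; apply: ge_ereal_inf.
  exists (guesswork (joint p rho E)); first by exists 'S_n, E.
  rewrite -strategy_guesswork_id //.
  apply: (guesswork_is_min (joint_ge0 p_ge0 rho_density E)).2.
  by exists id.
(* The minimizer [E0] is indexed by permutations, so it also competes in [quantum_guesswork2], which
   closes the cycle. *)
have le20 : (quantum_guesswork2 p rho <= quantum_guesswork p rho)%E.
  by rewrite quantumE v_id; apply: ereal_inf_lbound; exists E0.
split.
- split; last by move=> g; exact: ereal_inf_lbound.
  by rewrite quantumE; exists 'S_n, E0, id.
- by apply/eqP; rewrite eq_le le12 (le_trans le20 le01).
- by apply/eqP; rewrite eq_le le20 (le_trans le01 le12).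
Qed.
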